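(* Let $E$ be a finite-dimensional real vector space with inner product $x\cdot y$, let $\|\cdot\|$ be a norm on $E$, and let $\mathcal{K}\subset E$ be a convex, compact, full-dimensional set that is $\alpha_K$-strongly convex with respect to $\|\cdot\|$, $\alpha_K>0$. Let $f:E\to\mathbb{R}$ be (differentiable and) $\beta_f$-smooth and $\alpha_f$-strongly convex over $\mathcal{K}$ with respect to $\|\cdot\|$, $\alpha_f,\beta_f>0$. Let $x^*=\arg\min_{x\in\mathcal{K}}f(x)$, let $M=\frac{\sqrt{\alpha_f}\,\alpha_K}{8\sqrt{2}\,\beta_f}$, and let $D_{\mathcal{K}}=\max_{x,y\in\mathcal{K}}\|x-y\|$. Let $(x_t)_{t\ge 0}$ be any sequence of iterates produced by the Frank-Wolfe algorithm (defined in the context) applied to $f$ and $\mathcal{K}$ from an arbitrary starting point $x_0\in\mathcal{K}$. Then for every $t\ge 1$, $$f(x_t)-f(x^* )\le \frac{\max\{\frac{9}{2}\beta_f D_{\mathcal{K}}^2,\; 18M^{-2}\}}{(t+2)^2}=O\left(\frac{1}{t^2}\right).$$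
   Context: Smooth function: $f$ is $\beta$-smooth over a convex set $\mathcal{K}$ with respect to $\|\cdot\|$ if for all $x,y\in\mathcal{K}$, $f(y)\le f(x)+\nabla f(x)\cdot(y-x)+\frac{\beta}{2}\|x-y\|^2$. Strongly convex function: $f$ is $\alpha$-strongly convex over $\mathcal{K}$ with respect to $\|\cdot\|$ if it satisfies the following two equivalent conditions: (1) for all $x,y\in\mathcal{K}$, $f(y)\ge f(x)+\nabla f(x)\cdot(y-x)+\frac{\alpha}{2}\|x-y\|^2$; (2) for all $x,y\in\mathcal{K}$ and $\gamma\in[0,1]$, $f(\gamma x+(1-\gamma)y)\le\gamma f(x)+(1-\gamma)f(y)-\frac{\alpha}{2}\gamma(1-\gamma)\|x-y\|^2$. Strongly convex set: a convex set $\mathcal{K}\subset E$ is $\alpha$-strongly convex with respect to $\|\cdot\|$ if for any $x,y\in\mathcal{K}$, any $\gamma\in[0,1]$ and any $z\in E$ with $\|z\|=1$, $\gamma x+(1-\gamma)y+\gamma(1-\gamma)\frac{\alpha}{2}\|x-y\|^2 z\in\mathcal{K}$. Frank-Wolfe algorithm (with line search): $x_0\in\mathcal{K}$ is arbitrary. For $t=0,1,\dots$: choose $p_t\in\arg\min_{y\in\mathcal{K}}y\cdot\nabla f(x_t)$ (any minimizer, returned by a linear optimization oracle); choose $\eta_t\in\arg\min_{\eta\in[0,1]}\left(\eta(p_t-x_t)\cdot\nabla f(x_t)+\eta^2\frac{\beta_f}{2}\|p_t-x_t\|^2\right)$; set $x_{t+1}=x_t+\eta_t(p_t-x_t)$.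 *)

(* Defs.v *)
From HB Require Import structures.
From mathcomp Require Import all_boot all_order all_algebra.
From mathcomp Require Import all_classical all_reals all_analysis.

Set Implicit Arguments.
Unset Strict Implicit.
Unset Printing Implicit Defensive.

Import Order.TTheory GRing.Theory Num.Theory.
Import numFieldNormedType.Exports.

Local Open Scope classical_set_scope.
Local Open Scope ring_scope.

(* Finite-dimensional real normed spaces: the norm `|x| is arbitrary, and the
   topology is the one it induces. *)
#[short(type="finNormedModType")]
HB.structure Definition FinNormedModule (R : realType) :=
  { E of Vector R E & NormedModule R E }.

Section Defs.
Context {R : realType}.

Definition argmin {T : Type} (S : set T) (g : T -> R) : set T :=
  [set x | S x /\ forall y, S y -> g x <= g y].

Definition is_maximum (S : set R) (m : R) : Prop := S m /\ ubound S m.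

Section Space.
Context {E : finNormedModType R}.
Implicit Types (K : set E) (f : E -> R) (dot : {dot E for idfun}).

(* dim K is the dimension of the affine hull of K. *)
Definition affine_hull K : set E :=
  [set v | exists n (c : 'I_n -> R) (p : 'I_n -> E),
     [/\ forall i, K (p i), \sum_(i < n) c i = 1
       & v = \sum_(i < n) c i *: p i]].

Definition full_dimensional K : Prop := affine_hull K = setT.

(* The Riesz representative of 'd f x for dot; see gradP. *)
Definition grad dot f (x : E) : E :=
  get [set g : E | forall v, 'd f x v = dot g v].

Definition smooth_over dot (beta : R) K f : Prop :=
  forall x y, K x -> K y ->
    f y <= f x + dot (grad dot f x) (y - x) + beta / 2 * `|x - y| ^+ 2.

(* For f differentiable on a convex K this first-order form is equivalent to
   f (c x + (1 - c) y)
     <= c * f x + (1 - c) * f y - alpha / 2 * c * (1 - c) * `|x - y| ^+ 2. *)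
Definition strongly_convex_over dot (alpha : R) K f : Prop :=
  forall x y, K x -> K y ->
    f x + dot (grad dot f x) (y - x) + alpha / 2 * `|x - y| ^+ 2 <= f y.

Definition strongly_convex_set (alpha : R) K : Prop :=
  forall (x y z : E) (c : R), K x -> K y -> 0 <= c <= 1 -> `|z| = 1 ->
    K (c *: x + (1 - c) *: y
       + (c * (1 - c) * (alpha / 2) * `|x - y| ^+ 2) *: z).

Definition frank_wolfe dot (beta : R) K f
    (x p : nat -> E) (eta : nat -> R) : Prop :=
  K (x 0%N) /\
  forall t : nat,
    [/\ argmin K (fun y => dot y (grad dot f (x t))) (p t),
        argmin `[0, 1]
          (fun e => e * dot (p t - x t) (grad dot f (x t))
                    + e ^+ 2 * (beta / 2) * `|p t - x t| ^+ 2) (eta t)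
      & x t.+1 = x t + eta t *: (p t - x t)].

Lemma gradP dot f x v : 'd f x v = dot (grad dot f x) v.
Proof.
suff [g gP] : exists g : E, forall v, 'd f x v = dot g v.
  exact: (@getI _ [set g : E | forall v, 'd f x v = dot g v] g gP v).
pose h (g : E) : 'Hom(E, R^o) := linfun (dot g).
have hE g w : h g w = dot g w by rewrite lfunE.
have h_linear : linear h.
  by move=> c u w; apply/lfunP => z; rewrite add_lfunE scale_lfunE !hE linearPl.
pose H := linfun (HB.pack_for {linear E -> 'Hom(E, R^o)} h
  (GRing.isLinear.Build R E _ _ h h_linear)).
have HE g : H g = h g by rewrite lfunE.
have Hker : lker H == 0%VS.
  apply/lker0P => u w; rewrite !HE => huw; apply/eqP.
  rewrite -subr_eq0; apply/negP => /negP /(@neq0_dnorm_gt0 _ _ _ dot).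
  rewrite (@linearBl _ _ _ _ _ _ dot) /=.
  by rewrite -[dot u _]hE -[dot w _]hE huw subrr ltxx.
have Himg : limg H = fullv.
  apply/eqP; rewrite eqEdim subvf /= limg_dim_eq ?(eqP Hker) ?capv0//.
  by rewrite !dimvf /= /dim /= muln1.
have : linfun ('d f x : E -> R^o) \in limg H by rewrite Himg memvf.
move=> /memv_imgP[g _ dfg]; exists g => w.
by rewrite -hE -HE -dfg lfunE.
Qed.

End Space.
End Defs.

(* Main.v *)
(* Let h_t = f(x_t) - f(x* ), g the gradient at x_t, n = |p_t - x_t|^2.  Testing
   the optimality of p_t against the point that strong convexity of K provides
   above the midpoint of x_t and p_t, in the unit direction w from x_t to x*,
   gives (p_t - x_t).g <= (alpha_K / 4) n (w.g), while strong convexity of f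
   gives w.g <= - sqrt (2 alpha_f h_t).  Averaging the resulting bound with
   (p_t - x_t).g <= - h_t, the smoothness upper bound at step size
   min(1, 2 M sqrt h_t) yields
     h_(t+1) <= max(1/2, 1 - M sqrt h_t) h_t,
   and this recursion forces the rate 1/t^2. *)
Require Import Defs.
From HB Require Import structures.
From mathcomp Require Import all_boot all_order all_algebra.
From mathcomp Require Import all_classical all_reals all_analysis.
From mathcomp Require Import ring lra.

Set Implicit Arguments.
Unset Strict Implicit.
Unset Printing Implicit Defensive.

Import Order.TTheory GRing.Theory Num.Theory.
Import numFieldNormedType.Exports.

Local Open Scope classical_set_scope.
Local Open Scope ring_scope.

(** * Inner products and linear minimization over a strongly convex set *)

Section Dot.
Context (R : realType) (E : finNormedModType R) (dot : {dot E for idfun}).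
Implicit Types (u v w : E).

Lemma dotC u v : dot u v = dot v u.
Proof. by rewrite hermC expr0 mul1r. Qed.

Lemma dotDl u v w : dot (u + v) w = dot u w + dot v w.
Proof. exact: linearDl. Qed.

Lemma dotBl u v w : dot (u - v) w = dot u w - dot v w.
Proof. exact: linearBl. Qed.

Lemma dotZl (c : R) u w : dot (c *: u) w = c * dot u w.
Proof. exact: linearZl_LR. Qed.

End Dot.

(** The test point is the midpoint of [p] and [u] pushed by [alpha / 8 * |p - u|^2] along [w].
    Comparing [p] with it leaves half of [p - u] on the left; doubling gives [alpha / 4]. *)
Lemma lin_argmin_le (R : realType) (E : finNormedModType R)
    (dot : {dot E for idfun}) (K : set E) (alpha : R) (u p g w : E) :
  strongly_convex_set alpha K -> K u -> argmin K (dot^~ g) p -> `|w| = 1 ->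
  dot (p - u) g <= alpha / 4 * `|p - u| ^+ 2 * dot w g.
Proof.
move=> Kstrong Ku [Kp pmin] w1.
have half01 : 0 <= (2^-1 : R) <= 1 by lra.
have := pmin _ (Kstrong _ _ _ _ Kp Ku half01 w1).
rewrite dotBl !dotDl !dotZl /=.
set a := dot p g; set b := dot u g; set c := dot w g.
by move: (`|p - u| ^+ 2) => n; lra.
Qed.

Lemma convex_set_segment (R : realType) (E : lmodType R) (K : set E)
    (u p : E) (e : R) :
  convex_set K -> K u -> K p -> 0 <= e <= 1 -> K (u + e *: (p - u)).
Proof.
move=> Kconv Ku Kp /andP[e0 e1].
have /set_mem := Kconv p u (Itv01 e0 e1) (mem_set Kp) (mem_set Ku).
rewrite /conv /= /unstable.onem.
suff -> : u + e *: (p - u) = e *: p + (1 - e) *: u by [].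
by rewrite scalerBr scalerBl scale1r addrCA.
Qed.

(** * Progress of a single Frank-Wolfe step *)

Section FrankWolfe.
Context (R : realType) (E : finNormedModType R) (dot : {dot E for idfun}).
Context (K : set E) (f : E -> R) (beta : R) (x p : nat -> E) (eta : nat -> R).
Hypothesis K_convex : convex_set K.
Hypothesis f_smooth : smooth_over dot beta K f.
Hypothesis fw : frank_wolfe dot beta K f x p eta.

Lemma frank_wolfe_mem t : K (x t).
Proof.
elim: t => [|t IHt]; first by case: fw.
have [[Kp _] [eta01 _] ->] := fw.2 t.
by apply: convex_set_segment => //; rewrite /= in_itv /= in eta01.
Qed.

(** Line search minimizes exactly the upper bound that smoothness gives, so the step [eta t] can be
    traded for any [c] convenient to the analysis. *)
Lemma frank_wolfe_descent t (c : R) : 0 <= c <= 1 ->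
  f (x t.+1) <= f (x t) + c * dot (p t - x t) (grad dot f (x t))
                + c ^+ 2 * (beta / 2) * `|p t - x t| ^+ 2.
Proof.
move=> c01; have [_ [_ etamin] xS] := fw.2 t.
have {}etamin := etamin c; rewrite /= in_itv /= in etamin.
have {}etamin := etamin c01.
apply: le_trans (f_smooth (frank_wolfe_mem t) (frank_wolfe_mem t.+1)) _.
have d : x t.+1 - x t = eta t *: (p t - x t) by rewrite xS addrC addKr.
rewrite distrC d normrZ exprMn real_normK ?num_real//.
rewrite dotC dotZl; move: etamin.
by move: (dot _ _) (`|_| ^+ 2) => a n; lra.
Qed.

Lemma frank_wolfe_contraction (alphaK alphaf : R) (xstar : E) t :
  0 < alphaK -> 0 < alphaf -> 0 < beta ->
  strongly_convex_set alphaK K -> strongly_convex_over dot alphaf K f ->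
  argmin K f xstar ->
  f (x t.+1) - f xstar <=
    Num.max 2^-1 (1 - Num.sqrt alphaf * alphaK / (8 * Num.sqrt 2 * beta)
                      * Num.sqrt (f (x t) - f xstar)) * (f (x t) - f xstar).
Proof.
move=> aK0 af0 b0 Kstrong fstrong [Kxs xsmin].
set M := _ / _; pose h t := f (x t) - f xstar.
rewrite -/(h t) -/(h t.+1).
have Kx := frank_wolfe_mem t; have [pmin _ _] := fw.2 t.
have h0 : 0 <= h t by rewrite subr_ge0; apply: xsmin.
set s := M * Num.sqrt (h t).
have s0 : 0 <= s.
  by rewrite !mulr_ge0 ?sqrtr_ge0// ?invr_ge0 ?mulr_ge0 ?sqrtr_ge0// ltW.
set g := grad dot f (x t) in pmin *.
set a := dot (p t - x t) g; set n := `|p t - x t| ^+ 2.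
have n0 : 0 <= n by rewrite exprn_ge0.
have fstar := fstrong _ _ Kx Kxs; rewrite -/g dotC in fstar.
have ah : a <= - h t.
  have := pmin.2 _ Kxs; rewrite /= /a /h.
  have := mulr_ge0 (ltW af0) (exprn_ge0 2 (normr_ge0 (x t - xstar))).
  by move: fstar; rewrite !dotBl; lra.
(* The only unit vector needed is the one pointing from x_t to the minimizer,
   so the dual norm of the gradient never appears. *)
have as_ : a <= - (2 * beta * s * n).
  (* At the minimizer there is no direction to normalize, but then [s = 0] and [ah] suffices. *)
  have [xE|xNs] := eqVneq (x t) xstar.
    have ht0 : h t = 0 by rewrite /h xE subrr.
    by move: ah; rewrite /s ht0 sqrtr0; lra.
  set r := `|x t - xstar| in fstar.
  have r0 : 0 < r by rewrite normr_gt0 subr_eq0.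
  pose w := r^-1 *: (xstar - x t).
  have w1 : `|w| = 1.
    by rewrite normrZ distrC normfV normr_id mulVf// gt_eqF.
  have := lin_argmin_le Kstrong Kx pmin w1; rewrite -/a -/n.
  have wE : r * dot w g = dot (xstar - x t) g.
    by rewrite dotZl mulrA divff ?mul1r// gt_eqF.
  set q := Num.sqrt (2 * alphaf) * Num.sqrt (h t).
  have q0 : 0 <= q by rewrite mulr_ge0 ?sqrtr_ge0.
  have q2 : q ^+ 2 = 2 * alphaf * h t.
    by rewrite exprMn !sqr_sqrtr// mulr_ge0// ltW.
  have wq : dot w g <= - q.
    rewrite -(ler_pM2l r0) wE.
    (* AM-GM: [r * q <= h t + alphaf / 2 * r ^+ 2], and by strong convexity the right side is at
       most [- r * dot w g]. *)
    have : 0 <= (q - alphaf * r) ^+ 2 by rewrite sqr_ge0.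
    have : (q - alphaf * r) ^+ 2
      = 2 * alphaf * (h t + alphaf / 2 * r ^+ 2 - r * q).
      by rewrite sqrrB q2; field.
    move=> ->; rewrite pmulr_rge0 ?mulr_gt0//.
    by move: fstar; rewrite /h; lra.
  have sq : 8 * beta * s = alphaK * q / 2.
    have s2N0 : (Num.sqrt 2 : R) != 0 by rewrite sqrtr_eq0 -ltNge.
    have s2V : (Num.sqrt 2 : R)^-1 = Num.sqrt 2 / 2.
      by apply: (mulfI s2N0); rewrite mulfV// mulrA -expr2 sqr_sqrtr// mulfV.
    rewrite /s /M /q sqrtrM// !invfM s2V; field.
    by rewrite gt_eqF.
  have aKn : 0 <= alphaK / 4 * n by rewrite mulr_ge0// divr_ge0// ltW.
  have := ler_wpM2l aKn wq.
  (* By the choice of [M] this is twice the decrease claimed; the slack is dropped. *)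
  have : alphaK / 4 * n * - q = - (4 * beta * s * n).
    have -> : alphaK / 4 * n * - q = - (alphaK * q / 2 / 2 * n) by field.
    by rewrite -sq; field.
  have : 0 <= beta * s * n by apply: mulr_ge0 n0; apply: mulr_ge0 s0; apply: ltW.
  lra.
(* Half of [c * a] is bounded by [ah], half by [as_]. *)
have step c : 0 <= c <= 1 ->
    h t.+1 <= (1 - c / 2) * h t + c * beta * n * (c / 2 - s).
  move=> c01; have := frank_wolfe_descent t c01; rewrite -/g -/a -/n /h.
  have c0 : 0 <= c by case/andP: c01.
  have := ler_wpM2l c0 ah; have := ler_wpM2l c0 as_.
  rewrite /h; lra.
(* The error term of [step] vanishes at [c = 2 * s]; when this exceeds 1, the full step [c = 1]
   already makes the term nonpositive. *)
have [s_half|s_half] := leP 2^-1 s.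
  have one01 : 0 <= (1 : R) <= 1 by lra.
  have := step _ one01.
  have : 0 <= beta * n * (s - 2^-1).
    by apply: mulr_ge0; [apply: mulr_ge0 n0; apply: ltW|rewrite subr_ge0].
  have := ler_wpM2r h0 (_ : 2^-1 <= Num.max 2^-1 (1 - s)).
  rewrite le_max lexx => /(_ isT); lra.
have s01 : 0 <= 2 * s <= 1 by lra.
have := step _ s01.
have := ler_wpM2r h0 (_ : 1 - s <= Num.max 2^-1 (1 - s)).
rewrite le_max lexx orbT => /(_ isT).
rewrite [2 * s / 2](_ : _ = s) ?subrr ?mulr0; last by field.
lra.
Qed.

End FrankWolfe.

(** * The rate forced by the recursion *)

Lemma sqrt_contraction_rate (R : realType) (C M : R) (h : nat -> R) :
  0 < M -> 18 * M ^- 2 <= C -> (forall t, 0 <= h t) -> h 1%N <= C / 9 ->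
  (forall t, h t.+1 <= Num.max 2^-1 (1 - M * Num.sqrt (h t)) * h t) ->
  forall t, (1 <= t)%N -> h t <= C / (t%:R + 2) ^+ 2.
Proof.
move=> M0 CM h0 h1 hS; elim=> // -[_ _|t /(_ isT) IHt _].
  by apply: le_trans h1 _; rewrite (_ : (1%:R + 2) ^+ 2 = 9 :> R)//; ring.
have {}hS := hS t.+1; have {}h0 := h0 t.+1.
have : 1 <= (t.+1)%:R :> R by rewrite ler1n.
rewrite -[(t.+2)%:R]natr1.
move: IHt hS h0; move: (h t.+2) (h t.+1) (t.+1%:R : R) => h' k y ky h'k k0 y1.
have : 3 <= y + 2 by lra.
move: ky; rewrite addrAC; move: (y + 2) => a ky a3.
have C0 : 0 <= C.
  by apply: le_trans CM; rewrite mulr_ge0 ?invr_ge0 ?exprn_ge0 ?ltW.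
have a0 : 0 < a by lra.
rewrite ler_pdivlMr ?exprn_gt0// in ky.
rewrite ler_pdivlMr ?exprn_gt0 ?addr_gt0//.
(* Halving thus outpaces the growth of the denominator. This fails at [a = 2], so the induction
   starts at [t = 1]. *)
have a1_le : (a + 1) ^+ 2 <= 2 * a ^+ 2 by nra.
have a1_ge0 : 0 <= (a + 1) ^+ 2 by rewrite sqr_ge0.
have h'_le b : h' <= b * k -> b * (k * (a + 1) ^+ 2) <= C ->
    h' * (a + 1) ^+ 2 <= C.
  by move=> /(ler_wpM2r a1_ge0) h'b; apply: le_trans; rewrite mulrA.
have ka1 : k * (a + 1) ^+ 2 <= 2 * (k * a ^+ 2).
  by rewrite [leRHS]mulrCA ler_wpM2l.
have [s_half|s_half] := leP (1 - M * Num.sqrt k) 2^-1.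
  by apply: (h'_le 2^-1); [move: h'k; rewrite max_l|lra].
rewrite max_r ?(ltW s_half)// in h'k.
set s := Num.sqrt k in h'k; have s0 : 0 <= s := sqrtr_ge0 k.
have s2 : s ^+ 2 = k by rewrite sqr_sqrtr.
have Ms0 : 0 <= M * s := mulr_ge0 (ltW M0) s0.
(* If [k] is below half of its allowed bound, monotonicity alone suffices; otherwise [k] is large
   enough to force a strong contraction. *)
have [kC|Ck] := leP (2 * (k * a ^+ 2)) C.
  apply: (h'_le 1); last by lra.
  by apply: le_trans h'k _; rewrite ler_wpM2r//; lra.
(* Here [(M * s * a) ^+ 2] exceeds [M ^+ 2 * C / 2], and 18 is chosen so that this is at least 9.
   The contraction factor is then at most [1 - 3 / a]. *)
have Msa : 3 <= M * s * a.
  have : 3 ^+ 2 <= (M * s * a) ^+ 2.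
    have : 18 <= M ^+ 2 * C.
      by rewrite mulrC -ler_pdivrMr ?exprn_gt0.
    have := ler_wpM2l (sqr_ge0 M) (ltW Ck).
    rewrite !exprMn s2; lra.
  by rewrite ler_pXn2r ?nnegrE ?(mulr_ge0 Ms0 (ltW a0)).
have h'a : h' * a <= (a - 3) * k.
  have := ler_wpM2r (ltW a0) h'k; have := ler_wpM2r k0 Msa; lra.
have a3_ge0 : 0 <= a - 3 by lra.
have a2_ge0 : 0 <= a ^+ 2 by rewrite sqr_ge0.
have h'a3 : h' * a ^+ 3 <= (a - 3) * C.
  apply: le_trans (ler_wpM2l a3_ge0 ky).
  by have := ler_wpM2r a2_ge0 h'a; rewrite -!mulrA -exprS.
rewrite -(ler_pM2r (exprn_gt0 3 a0)).
have := ler_wpM2r a1_ge0 h'a3.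
have : (a - 3) * (a + 1) ^+ 2 <= a ^+ 3 by nra.
move=> /(ler_wpM2l C0); lra.
Qed.

(** * Asymptotic form and conclusion *)

Lemma inv_sqr_bigO (R : realType) (C : R) (h : nat -> R) :
  (forall t, (1 <= t)%N -> 0 <= h t <= C / (t%:R + 2) ^+ 2) ->
  h =O_\oo (fun t : nat => t%:R ^- 2 : R).
Proof.
(* The big-O constant must be positive, hence [|C| + 1]. *)
move=> hC; apply/eqO_exP; exists (`|C| + 1); first by rewrite ltr_wpDl.
(* At [t = 0] the comparison function is 0, since [0^-1 = 0]. *)
near=> t; have t1 : (1 <= t)%N by near: t; exists 1%N.
have /andP[h0 hle] := hC t t1.
have t0 : 0 < t%:R :> R by rewrite ltr0n.
rewrite ger0_norm// (le_trans hle)// [`|_ ^- 2|]ger0_norm ?invr_ge0 ?exprn_ge0//.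
apply: (@le_trans _ _ ((`|C| + 1) / (t%:R + 2) ^+ 2)).
  by rewrite ler_wpM2r ?invr_ge0 ?exprn_ge0 ?addr_ge0// ler_wpDr// ler_norm.
rewrite ler_wpM2l ?addr_ge0// lef_pV2 ?posrE ?exprn_gt0 ?addr_gt0//.
by rewrite lerXn2r ?nnegrE ?addr_ge0// ler_wpDr.
Unshelve. all: by end_near. Qed.

Theorem theorem2 (R : realType) (E : finNormedModType R)
    (dot : {dot E for idfun}) (K : set E) (f : E -> R)
    (alphaK alphaf betaf D : R) (xstar : E)
    (x p : nat -> E) (eta : nat -> R)
    (alphaK_gt0 : 0 < alphaK) (alphaf_gt0 : 0 < alphaf) (betaf_gt0 : 0 < betaf)
    (K_convex : convex_set K) (K_compact : compact K)
    (K_full : full_dimensional K) (K_strong : strongly_convex_set alphaK K)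
    (f_diff : forall y, K y -> differentiable f y)
    (f_smooth : smooth_over dot betaf K f)
    (f_strong : strongly_convex_over dot alphaf K f)
    (xstarP : argmin K f xstar)
    (DP : is_maximum [set `|u - v| | u in K & v in K] D)
    (fw : frank_wolfe dot betaf K f x p eta) :
  let M : R := Num.sqrt alphaf * alphaK / (8 * Num.sqrt 2 * betaf) in
  let bound : nat -> R := fun t =>
    Num.max (9 / 2 * betaf * D ^+ 2) (18 * M ^- 2) / (t%:R + 2) ^+ 2 in
  [/\ forall t : nat, (1 <= t)%N -> f (x t) - f xstar <= bound t,
      bound =O_\oo (fun t : nat => t%:R ^- 2 : R)
    & (fun t : nat => f (x t) - f xstar) =O_\oo (fun t : nat => t%:R ^- 2 : R)].
Proof.
move=> M bound.
set C := Num.max (9 / 2 * betaf * D ^+ 2) (18 * M ^- 2) in bound *.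
pose h t := f (x t) - f xstar.
have M0 : 0 < M by rewrite !(divr_gt0, mulr_gt0) ?sqrtr_gt0.
have h0 t : 0 <= h t.
  by rewrite subr_ge0; apply: xstarP.2; apply: frank_wolfe_mem fw t.
have C0 : 0 <= C.
  by rewrite le_max orbC mulr_ge0 ?invr_ge0 ?exprn_ge0// ltW.
(* A full step from [x 0] gives [h 1 <= betaf / 2 * D ^+ 2]: the linear term is at most [- h 0], by
   optimality of [p 0] and convexity. The factor [9 / 2] in [C] absorbs [(1 + 2) ^+ 2 = 9]. *)
have h1 : h 1%N <= C / 9.
  have Kx0 : K (x 0%N) := frank_wolfe_mem K_convex fw 0%N.
  have [[Kp pmin] _ _] := fw.2 0%N.
  have c1 : 0 <= (1 : R) <= 1 by lra.
  have := frank_wolfe_descent K_convex f_smooth fw 0%N c1.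
  have := pmin _ xstarP.1; have := f_strong _ _ Kx0 xstarP.1.
  have pD : `|p 0%N - x 0%N| ^+ 2 <= D ^+ 2.
    have pxD : `|p 0%N - x 0%N| <= D.
      by apply: DP.2; exists (p 0%N) => //; exists (x 0%N).
    by rewrite lerXn2r ?nnegrE// (le_trans _ pxD).
  have := ler_wpM2l (ltW betaf_gt0) pD.
  have := mulr_ge0 (ltW alphaf_gt0) (exprn_ge0 2 (normr_ge0 (x 0%N - xstar))).
  have : 9 / 2 * betaf * D ^+ 2 <= C by rewrite le_max lexx.
  rewrite dotC !dotBl /h; lra.
have hbound t : (1 <= t)%N -> h t <= bound t.
  move: t; apply: (sqrt_contraction_rate M0) => //.
    by rewrite le_max lexx orbT.
  by move=> t; apply: (frank_wolfe_contraction K_convex f_smooth fw).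
split => //; apply: (@inv_sqr_bigO _ C) => t t1.
  by rewrite lexx andbT divr_ge0// exprn_ge0// addr_ge0.
by apply/andP; split; [apply: h0|apply: hbound].
Qed.
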